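(* Fix integers $2\le k\le n$. For any $\ell,\ell'\in\{0,\dots,n\}$, the block diagonal matching field polytopes $P_{\mathcal{B}_\ell}$ and $P_{\mathcal{B}_{\ell'}}$ for ${\rm Gr}(k,n)$ can be obtained from one another by a sequence of combinatorial mutations such that all intermediate polytopes are matching field polytopes.
   Context: Let $\mathbf{I}_{k,n}$ be the set of $k$-subsets of $[n]$. A matching field $\Lambda$ is a choice of permutation $\Lambda(I)\in S_k$ for each $I=\{i_1<\dots<i_k\}\in\mathbf{I}_{k,n}$; with $\sigma=\Lambda(I)$ its associated monomial is $x_{\sigma(1)i_1}\cdots x_{\sigma(k)i_k}$ in the entries of a $k\times n$ matrix of variables. Its matching field polytope $P_\Lambda\subset\mathbb{R}^{k\times n}$ is the convex hull of the exponent vectors $\sum_{r=1}^k e_{\sigma(r),i_r}$ of these monomials, $e_{i,j}$ being the standard basis matrices. For $0\le\ell\le n$ the block diagonal matching field $\mathcal{B}_\ell$ is defined by $\mathcal{B}_\ell(I)=\mathrm{id}$ if $|I\cap\{1,\dots,\ell\}|\neq 1$ and $\mathcal{B}_\ell(I)=(12)$ (transposition of $1,2$) otherwise. Combinatorial mutation: let $N\cong\mathbb{Z}^d$, $M=\mathrm{Hom}(N,\mathbb{Z})$, $w\in M$ primitive, $F\subset w^\perp\subset N_\mathbb{R}$ a lattice polytope; the tropical map is $\varphi_{w,F}(u)=u-u_{\min}w$ with $u_{\min}=\min_{f\in F}\langle f,u\rangle$. If $P\subset M_\mathbb{R}$ is a lattice polytope containing the origin and $\varphi_{w,F}(P)$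 is convex, it is a combinatorial mutation of $P$. A sequence of combinatorial mutations is a finite chain of polytopes in which consecutive polytopes are related, after identification via lattice-preserving affine isomorphisms (unimodular equivalences) of the lattices they span, either by a unimodular equivalence or by a combinatorial mutation. *)

(* Defs.v *)
From HB Require Import structures.
From mathcomp Require Import all_boot all_order all_algebra all_fingroup.
From mathcomp Require Import reals.
Set Implicit Arguments. Unset Strict Implicit. Unset Printing Implicit Defensive.
Import Order.TTheory GRing.Theory Num.Theory.
Local Open Scope ring_scope.

Section Polytopes.
Variable R : realType.

Definition isZpt {D : nat} (x : 'rV[R]_D) : Prop := forall i, x 0 i \is a Num.int.

Definition conv {D : nat} (s : seq 'rV[R]_D) (x : 'rV[R]_D) : Prop :=
  exists lam : 'I_(size s) -> R,
    (forall i, 0 <= lam i) /\ \sum_i lam i = 1 /\ x = \sum_i lam i *: s`_i.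

Definition lattice_polytope {D : nat} (P : 'rV[R]_D -> Prop) : Prop :=
  exists s : seq 'rV[R]_D, (0 < size s)%N /\ (forall i : 'I_(size s), isZpt s`_i) /\
    forall x, P x <-> conv s x.

Definition in_aff {D : nat} (P : 'rV[R]_D -> Prop) (x : 'rV[R]_D) : Prop :=
  exists s : seq 'rV[R]_D, (forall i : 'I_(size s), P s`_i) /\
    exists lam : 'I_(size s) -> R, \sum_i lam i = 1 /\ x = \sum_i lam i *: s`_i.

Definition lat {D : nat} (P : 'rV[R]_D -> Prop) (x : 'rV[R]_D) : Prop :=
  in_aff P x /\ isZpt x.

Definition affmap {D E : nat} (A : 'M[R]_(D, E)) (b : 'rV[R]_E) (x : 'rV[R]_D) : 'rV[R]_E :=
  x *m A + b.

Definition lat_iso {D E : nat} (f : 'rV[R]_D -> 'rV[R]_E)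
  (L1 : 'rV[R]_D -> Prop) (L2 : 'rV[R]_E -> Prop) : Prop :=
  (forall x, L1 x -> L2 (f x)) /\
  (forall x y, L1 x -> L1 y -> f x = f y -> x = y) /\
  (forall y, L2 y -> exists x, L1 x /\ f x = y).

Definition image_of {D E : nat} (f : 'rV[R]_D -> 'rV[R]_E) (P : 'rV[R]_D -> Prop)
  (y : 'rV[R]_E) : Prop := exists x, P x /\ f x = y.

Definition unimod_equiv {D : nat} (P Q : 'rV[R]_D -> Prop) : Prop :=
  exists (A : 'M[R]_(D, D)) (b : 'rV[R]_D),
    lat_iso (affmap A b) (lat P) (lat Q) /\
    forall y, Q y <-> image_of (affmap A b) P y.

Definition pairing {d : nat} (f u : 'rV[R]_d) : R := \sum_i f 0 i * u 0 i.

Definition primitive {d : nat} (w : 'rV[R]_d) : Prop :=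
  isZpt w /\ w != 0 /\
  forall (c : R) (v : 'rV[R]_d), c \is a Num.int -> isZpt v -> w = c *: v ->
    c = 1 \/ c = -1.

Definition is_umin {d : nat} (F : 'rV[R]_d -> Prop) (u : 'rV[R]_d) (m : R) : Prop :=
  (exists f, F f /\ pairing f u = m) /\ (forall f, F f -> m <= pairing f u).

Definition trop_image {d : nat} (w : 'rV[R]_d) (F : 'rV[R]_d -> Prop)
  (P : 'rV[R]_d -> Prop) (y : 'rV[R]_d) : Prop :=
  exists u, P u /\ exists m, is_umin F u m /\ y = u - m *: w.

(* Q is a combinatorial mutation of P, after identifying the affine lattices
   spanned by P and by Q with Z^d via lattice-preserving affine isomorphisms
   g and g'.  F = conv T is a lattice polytope in w^perp; the convexity of
   phi_{w,F}(g(P)) is automatic since it equals the affine image g'(Q). *)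
Definition comb_mutation {D : nat} (P Q : 'rV[R]_D -> Prop) : Prop :=
  exists (d : nat) (A : 'M[R]_(D, d)) (b : 'rV[R]_d) (A' : 'M[R]_(D, d)) (b' : 'rV[R]_d)
         (w : 'rV[R]_d) (T : seq 'rV[R]_d),
    lattice_polytope P /\ lattice_polytope Q /\
    lat_iso (affmap A b) (lat P) isZpt /\
    lat_iso (affmap A' b') (lat Q) isZpt /\
    image_of (affmap A b) P 0 /\
    primitive w /\
    (0 < size T)%N /\ (forall i : 'I_(size T), isZpt T`_i /\ pairing T`_i w = 0) /\
    forall y, image_of (affmap A' b') Q y <->
              trop_image w (conv T) (image_of (affmap A b) P) y.

Definition mutation_step {D : nat} (P Q : 'rV[R]_D -> Prop) : Prop :=
  unimod_equiv P Q \/ comb_mutation P Q \/ comb_mutation Q P.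

Definition matching_field (k n : nat) := {set 'I_n} -> 'S_k.

(* exponent vector sum_r e_{sigma(r), i_r} where I = {i_0 < ... < i_{k-1}} *)
Definition expvec {k n : nat} (sigma : 'S_k) (J : {set 'I_n}) : 'M[R]_(k, n) :=
  \sum_(r < k) \sum_(j : 'I_n | (j \in J) && (index j (enum J) == r)) delta_mx (sigma r) j.

Definition mf_points {k n : nat} (L : matching_field k n) : seq 'rV[R]_(k * n) :=
  [seq mxvec (expvec (L J) J) | J <- enum [set J : {set 'I_n} | #|J| == k]].

Definition mf_polytope {k n : nat} (L : matching_field k n) : 'rV[R]_(k * n) -> Prop :=
  conv (mf_points L).

End Polytopes.

(* block diagonal matching field B_l : identity unless |I cap {1..l}| = 1,
   in which case the transposition (1 2) (ordinals 0 and 1 here).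
   For k < 2 (excluded by the theorem) it is defined as the identity. *)
Definition block_diag (k n l : nat) : matching_field k n :=
  match k as k0 return matching_field k0 n with
  | k'.+2 => fun J => if (#|[set j in J | (j < l)%N]| == 1)%N
                      then tperm (ord0 : 'I_k'.+2) (inord 1) else 1%g
  | _ => fun _ => 1%g
  end.

(* Main.v *)
Require Import Defs.
From HB Require Import structures.
From mathcomp Require Import all_boot all_order all_algebra all_fingroup.
From mathcomp Require Import reals ring lra zify.

(* Only the two smallest elements of a k-set are permuted by B_l, so B_l is
   the matching field that lists them in the order l+1, ..., n, 1, ..., l of [n]
   and is the identity elsewhere.  Moving l+1 from the first to the last place
   of this order by adjacent transpositions leads from B_l to B_(l+1).

   Exchanging consecutive elements c, d of the order alters only the vertices
   e_(1,c) + e_(2,d) + ..., by w = e_(1,d) + e_(2,c) - e_(1,c) - e_(2,d).  Let g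
   send a vertex with a in row 1 and b in row 2 to
   [b is above c and d] - [a is not below c and d].  Then g takes the values
   -1, 0, 1 on the vertices, and -1 exactly on those that move, so the vertices
   correspond under the tropical map x |-> x - min(0, g x) w.  The polytopes
   correspond too: if g v = 1 and g v' = -1 then exchanging the row 2 entries of
   v and v' (and if necessary their rows below) writes v + v' as a sum of two
   vertices with g = 0, so the hyperplane g = 0 meets both polytopes in the hull
   of common vertices. *)

Set Implicit Arguments. Unset Strict Implicit. Unset Printing Implicit Defensive.
Import Order.TTheory GRing.Theory Num.Theory.
Local Open Scope ring_scope.

(** * Weighted convex combinations, and the tropical map on convex hulls *)

Section Convexity.
Variables (R : realType) (D : nat).
Implicit Types (s V W : seq 'rV[R]_D) (x y v w : 'rV[R]_D) (g : 'cV[R]_D) (t c : R).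

(** The total weight is a parameter, so that a convex combination can be assembled from partial
    sums; [wconv s 1] unfolds to [conv s]. *)
Definition wconv s t x : Prop :=
  exists lam : 'I_(size s) -> R,
    (forall i, 0 <= lam i) /\ \sum_i lam i = t /\ x = \sum_i lam i *: s`_i.

Lemma wconv0 s : wconv s 0 0.
Proof.
exists (fun=> 0); split=> //; split; first by rewrite big1.
by rewrite big1 // => i _; rewrite scale0r.
Qed.

Lemma wconvD s t1 t2 x1 x2 :
  wconv s t1 x1 -> wconv s t2 x2 -> wconv s (t1 + t2) (x1 + x2).
Proof.
move=> [l1 [p1 [e1 ->]]] [l2 [p2 [e2 ->]]]; exists (fun i => l1 i + l2 i).
split=> [i|]; first exact: addr_ge0.
rewrite big_split /= e1 e2 -big_split /=; split=> //.
by apply: eq_bigr => i _; rewrite scalerDl.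
Qed.

Lemma wconvZ s c t x : 0 <= c -> wconv s t x -> wconv s (c * t) (c *: x).
Proof.
move=> c0 [l [p [e ->]]]; exists (fun i => c * l i).
split=> [i|]; first exact: mulr_ge0.
rewrite -mulr_sumr e scaler_sumr; split=> //.
by apply: eq_bigr => i _; rewrite scalerA.
Qed.

Lemma wconv_sum (I : finType) (P : pred I) s (t : I -> R) (x : I -> 'rV[R]_D) :
  (forall i, P i -> wconv s (t i) (x i)) ->
  wconv s (\sum_(i | P i) t i) (\sum_(i | P i) x i).
Proof.
move=> h; apply: (big_ind2 (wconv s)) => //; first exact: wconv0.
by move=> *; apply: wconvD.
Qed.

Lemma wconv_mem s x : x \in s -> wconv s 1 x.
Proof.
move=> xs; have hx : (index x s < size s)%N by rewrite index_mem.
exists (fun i => (i == Ordinal hx)%:R); split=> [i|]; first exact: ler0n.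
split.
  rewrite (bigD1 (Ordinal hx)) //= eqxx big1 ?addr0 // => i /negPf ->.
  by [].
rewrite (bigD1 (Ordinal hx)) //= eqxx scale1r nth_index // big1 ?addr0 //.
by move=> i /negPf ->; rewrite scale0r.
Qed.

Lemma wconv_sub s s' t x :
  (forall y, y \in s -> wconv s' 1 y) -> wconv s t x -> wconv s' t x.
Proof.
move=> h [l [p [<- ->]]]; apply: wconv_sum => i _.
by rewrite -[X in wconv _ X _]mulr1; apply: wconvZ => //; apply/h/mem_nth.
Qed.

Definition ev g x : R := (x *m g) 0 0.

Lemma evD g x y : ev g (x + y) = ev g x + ev g y.
Proof. by rewrite /ev mulmxDl mxE. Qed.
Lemma evZ g c x : ev g (c *: x) = c * ev g x.
Proof. by rewrite /ev -scalemxAl mxE. Qed.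
Lemma evN g x : ev (- g) x = - ev g x.
Proof. by rewrite /ev mulmxN mxE. Qed.
Lemma ev_sum g (I : finType) (P : pred I) (x : I -> 'rV[R]_D) :
  ev g (\sum_(i | P i) x i) = \sum_(i | P i) ev g (x i).
Proof. by rewrite /ev mulmx_suml summxE. Qed.

(* The negative part of the weight is absorbed by pairing each negative point
   with the positive ones, proportionally to their weights. *)
Lemma conv_halfspace s s' g x :
  (forall v, v \in s -> ev g v = -1 \/ ev g v = 0 \/ ev g v = 1) ->
  (forall v, v \in s -> 0 <= ev g v -> conv s' v) ->
  (forall v v', v \in s -> v' \in s -> ev g v = 1 -> ev g v' = -1 ->
     wconv s' 2 (v + v')) ->
  conv s x -> 0 <= ev g x -> conv s' x.
Proof.
move=> hg hp hm [l [l0 [l1 ->]]].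
pose a (i : 'I_(size s)) := ev g s`_i.
have ha i : a i = -1 \/ a i = 0 \/ a i = 1 by apply/hg/mem_nth.
pose P := \sum_(i | a i == 1) l i; pose N := \sum_(i | a i == -1) l i.
have P0 : 0 <= P by apply: sumr_ge0.
have N0 : 0 <= N by apply: sumr_ge0.
have nm1 : (-1 == 1 :> R) = false by apply/eqP; lra.
have n01 : (0 == 1 :> R) = false by apply/eqP; lra.
have n0m : (0 == -1 :> R) = false by apply/eqP; lra.
have n1m : (1 == -1 :> R) = false by apply/eqP; lra.
(* The module is arbitrary because both sums of weights (in [R^o]) and sums of points get split. *)
have split3 (Z : lmodType R) (F : 'I_(size s) -> Z) :
    \sum_i F i = \sum_(i | a i == 1) F i + \sum_(i | a i == -1) F i
                 + \sum_(i | a i == 0) F i.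
  rewrite (bigID (fun i => a i == 1)) /= -addrA; congr (_ + _).
  rewrite (bigID (fun i => a i == -1)) /=; congr (_ + _); apply: eq_bigl => i;
  by case: (ha i) => [->|[->|->]]; rewrite ?eqxx ?nm1 ?n01 ?n0m ?n1m //
    eq_sym ?oner_eq0 ?n0m //= ?oppr_eq0 ?oner_eq0.
rewrite ev_sum => gx.
have {gx} NP : N <= P.
  move: gx; rewrite (split3 R^o) /=.
  rewrite (eq_bigr l); last by move=> i /eqP h; rewrite evZ -/(a i) h mulr1.
  rewrite [X in _ + X + _](eq_bigr (fun i => - l i)); last first.
    by move=> i /eqP h; rewrite evZ -/(a i) h mulrN1.
  rewrite [X in _ + X](eq_bigr (fun=> 0)); last first.
    by move=> i /eqP h; rewrite evZ -/(a i) h mulr0.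
  by rewrite sumrN big1_eq addr0 subr_ge0.
have key : \sum_i l i *: s`_i =
    \sum_(i | a i == 1) (l i * (1 - N / P)) *: s`_i
  + \sum_(i | a i == 1) \sum_(j | a j == -1) (l i * l j / P) *: (s`_i + s`_j)
  + \sum_(i | a i == 0) l i *: s`_i.
  rewrite (split3 'rV[R]_D); congr (_ + _).
  under [X in _ = _ + X]eq_bigr => i _ do
    (under eq_bigr => j _ do rewrite scalerDr; rewrite big_split /=).
  rewrite big_split /= addrA; congr (_ + _).
    rewrite -big_split /=; apply: eq_bigr => i _.
    rewrite -scaler_suml -scalerDl; congr (_ *: _).
    rewrite -mulr_suml -mulr_sumr -/N; ring.
  rewrite exchange_big /=; apply: eq_bigr => j hj.
  rewrite -scaler_suml; congr (_ *: _).
  have -> : \sum_(i | a i == 1) l i * l j / P = P * (l j / P).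
    by rewrite /P mulr_suml; apply: eq_bigr => i _; rewrite mulrA.
  (* If [P = 0] the right side is 0, and so is [l j], because [0 <= l j <= N <= P]. *)
  have [P00|P00] := eqVneq P 0; last by field.
  have : l j <= N by rewrite /N (bigD1 j) //= lerDl; apply: sumr_ge0.
  by rewrite P00 mul0r; have := l0 j; lra.
have tot : 1 = \sum_(i | a i == 1) (l i * (1 - N / P))
  + \sum_(i | a i == 1) \sum_(j | a j == -1) (l i * l j / P * 2)
  + \sum_(i | a i == 0) l i.
  rewrite -[LHS]l1 (split3 R^o); congr (_ + _).
  rewrite -mulr_suml -/P -/N.
  have -> : \sum_(i | a i == 1) \sum_(j | a j == -1) l i * l j / P * 2
            = P * (N / P * 2).
    rewrite [LHS](eq_bigr (fun i => l i * (N / P * 2))) ?mulr_suml // => i _.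
    by rewrite -!mulr_suml -mulr_sumr -/N !mulrA.
  have [P00|P00] := eqVneq P 0; last by field.
  by have -> : N = 0 by [lra]; rewrite P00; ring.
rewrite /conv -/(wconv s' 1 _) tot key.
apply: wconvD; first apply: wconvD.
- apply: wconv_sum => i /eqP ai; rewrite -[X in wconv _ X _]mulr1.
  apply: wconvZ; last by apply: hp; [exact: mem_nth | rewrite -/(a i) ai].
  apply: mulr_ge0 => //; rewrite subr_ge0.
  have [P00|P00] := eqVneq P 0; first by rewrite P00 invr0 mulr0.
  by rewrite ler_pdivrMr ?mul1r // lt_def P00.
- apply: wconv_sum => i /eqP ai; apply: wconv_sum => j /eqP aj.
  apply: wconvZ; first by rewrite !mulr_ge0 ?invr_ge0.
  by apply: hm; rewrite ?mem_nth.
- apply: wconv_sum => i /eqP ai; rewrite -[X in wconv _ X _]mulr1.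
  by apply: wconvZ => //; apply: hp; [exact: mem_nth | rewrite -/(a i) ai].
Qed.

Lemma wconv_map E (A : 'M[R]_(D, E)) s t x : wconv s t x ->
  exists lam : 'I_(size s) -> R,
    (forall i, 0 <= lam i) /\ \sum_i lam i = t /\
    x *m A = \sum_i lam i *: (s`_i *m A).
Proof.
move=> [l [p [e ->]]]; exists l; do 2 split=> //.
by rewrite mulmx_suml; apply: eq_bigr => i _; rewrite scalemxAl.
Qed.

Definition shear g w x : 'rV[R]_D := x - ev g x *: w.
(** The tropical map for the segment from 0 to [g]: the identity where [g] is nonnegative, and the
    linear map [shear] where it is nonpositive. *)
Definition trop g w x : 'rV[R]_D := x - Num.min 0 (ev g x) *: w.

Lemma shearE g w x : shear g w x = x *m (1%:M - g *m w).
Proof.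
rewrite /shear mulmxBr mulmx1; congr (_ - _).
by rewrite mulmxA [x *m g]mx11_scalar mul_scalar_mx.
Qed.

Lemma ev_shear g w x : w *m g = 0 -> ev g (shear g w x) = ev g x.
Proof.
by move=> wg; rewrite /shear evD -scaleNr evZ {3}/ev wg mxE mulr0 addr0.
Qed.

Lemma ev_trop g w x : w *m g = 0 -> ev g (trop g w x) = ev g x.
Proof.
by move=> wg; rewrite /trop evD -scaleNr evZ {3}/ev wg mxE mulr0 addr0.
Qed.

(** A shift along [w] leaves [g] unchanged, so the two shifts are by opposite multiples of [w]. *)
Lemma tropK g w x : w *m g = 0 -> trop g w (trop g (- w) x) = x.
Proof.
move=> wg; rewrite {1}/trop ev_trop ?mulNmx ?wg ?oppr0 //.
by rewrite /trop scalerN opprK addrK.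
Qed.

Lemma conv_linear s s' (A : 'M[R]_D) x :
  (forall v, v \in s -> conv s' (v *m A)) -> conv s x -> conv s' (x *m A).
Proof.
move=> h /(wconv_map A) [l [l0 [l1 ->]]]; rewrite /conv -/(wconv s' 1 _) -l1.
apply: wconv_sum => i _; rewrite -[X in wconv _ X _]mulr1.
by apply: wconvZ => //; apply/h/mem_nth.
Qed.

(** On each side of the hyperplane [g = 0] the map is linear, so [conv_halfspace] applies on each:
    to [V] where [g] is nonnegative, and to the sheared points with [- g] otherwise. Shearing
    preserves [v + v'] when the values of [g] at [v] and [v'] are opposite, so the same hypothesis
    on sums serves both sides. *)
Lemma conv_trop V W g w x :
  w *m g = 0 ->
  (forall v, v \in V -> ev g v = -1 \/ ev g v = 0 \/ ev g v = 1) ->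
  (forall v, v \in V -> trop g w v \in W) ->
  (forall v v', v \in V -> v' \in V -> ev g v = 1 -> ev g v' = -1 ->
     wconv W 2 (v + v')) ->
  conv V x -> conv W (trop g w x).
Proof.
move=> wg hg hW hm hx; have [gx|gx] := leP 0 (ev g x).
  rewrite /trop min_l // scale0r subr0.
  apply: (conv_halfspace hg) hx gx => // v vV gv.
  apply: wconv_mem; have := hW v vV.
  by rewrite /trop min_l // scale0r subr0.
have -> : trop g w x = shear g w x by rewrite /trop /shear min_r ?ltW.
pose S := map (shear g w) V.
have hS : conv S (shear g w x).
  rewrite shearE; apply: conv_linear hx => v vV; apply: wconv_mem.
  by rewrite -shearE map_f.
apply: (@conv_halfspace S W (- g)) hS _.
- move=> _ /mapP[v vV ->]; rewrite evN ev_shear //.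
  by case: (hg v vV) => [|[|]] ->; [right; right|right; left|left]; lra.
- move=> _ /mapP[v vV ->]; rewrite evN ev_shear // oppr_ge0 => gv.
  apply: wconv_mem; have := hW v vV.
  by rewrite /trop /shear min_r.
- move=> _ _ /mapP[v vV ->] /mapP[v' vV' ->]; rewrite !evN !ev_shear // => e e'.
  have -> : shear g w v + shear g w v' = v' + v.
    have -> : v' + v = v + v' by rewrite addrC.
    rewrite /shear.
    have -> : ev g v = -1 by lra.
    have -> : ev g v' = 1 by lra.
    by rewrite scaleN1r scale1r opprK addrACA subrr addr0.
  by apply: hm => //; lra.
- by rewrite evN ev_shear // oppr_ge0 ltW.
Qed.

End Convexity.

(** * Lattices spanned by polytopes, unimodular equivalences and mutations *)

Section Lattices.
Variable R : realType.

Lemma isZptP D (x : 'rV[R]_D) : isZpt x <-> x \is a mxOver Num.int.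
Proof.
split=> [h|/mxOverP h i]; last exact: h.
by apply/mxOverP => i j; rewrite ord1; apply: h.
Qed.

Lemma intmxN m n (A : 'M[R]_(m, n)) :
  A \is a mxOver Num.int -> - A \is a mxOver Num.int.
Proof. by move=> /mxOverP h; apply/mxOverP => i j; rewrite mxE rpredN. Qed.

Lemma intmxD m n (A B : 'M[R]_(m, n)) : A \is a mxOver Num.int ->
  B \is a mxOver Num.int -> A + B \is a mxOver Num.int.
Proof.
by move=> /mxOverP hA /mxOverP hB; apply/mxOverP => i j; rewrite mxE rpredD.
Qed.

(** Provides coordinates on the lattice of integer points in the row space of [M]. In the Smith
    normal form [M = L *m Dl *m U], the rows of the unimodular [U] at nonzero diagonal entries form
    [B], and the matching columns of its inverse form [A]; multiplication by [A] then identifies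
    this lattice with the integer vectors of length [d]. *)
Lemma lattice_coordinates m D (M : 'M[R]_(m, D)) : M \is a mxOver Num.int ->
  exists d (A : 'M[R]_(D, d)) (B : 'M[R]_(d, D)),
    A \is a mxOver Num.int /\ B \is a mxOver Num.int /\
    B *m A = 1%:M /\ (B :=: M)%MS.
Proof.
move=> /mxOverP Mint.
have [L uL [U uU [e _ ME]]] := int_Smith_normal_form (map_mx Num.floor M).
pose f := map_mx (intr : int -> R).
pose Dl : 'M[int]_(m, D) := \matrix_(i, j) (e`_i *+ (i == j :> nat)).
have {}ME : M = f _ _ (L *m Dl) *m f _ _ U.
  rewrite -map_mxM -ME; apply/matrixP => i j; rewrite !mxE.
  by have := Mint i j; rewrite intrEfloor => /eqP.
pose S := [set j : 'I_D | (j < m)%N && (e`_j != 0)].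
pose h : 'I_#|S| -> 'I_D := enum_val.
exists #|S|, (\matrix_(i, j) f _ _ (invmx U) i (h j)),
  (\matrix_(i, j) f _ _ U (h i) j).
have UV : f _ _ U *m f _ _ (invmx U) = 1%:M by rewrite -map_mxM mulmxV // map_mx1.
split; first by apply/mxOverP => i j; rewrite !mxE intr_int.
split; first by apply/mxOverP => i j; rewrite !mxE intr_int.
split.
  apply/matrixP => i j; have := congr1 (fun X : 'M_D => X (h i) (h j)) UV.
  rewrite !mxE (inj_eq enum_val_inj) => <-.
  by apply: eq_bigr => l _; rewrite !mxE.
apply/eqmxP/andP; split.
  (* [L] is invertible, so the rows of [Dl *m U] lie in the row space of [M]; a row of [B] is such a
     row divided by its nonzero invariant factor. *)
  have DM : (f _ _ (Dl *m U) <= M)%MS.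
    apply/submxP; exists (f _ _ (invmx L)).
    by rewrite ME -!map_mxM !mulmxA mulVmx // mul1mx.
  apply/row_subP => i.
  have := enum_valP i; rewrite -/(h i) inE => /andP[hm hn].
  have -> : row i (\matrix_(i, j) f _ _ U (h i) j) =
     (e`_(h i))%:~R^-1 *: row (Ordinal hm) (f _ _ (Dl *m U)).
    apply/rowP => j; rewrite !mxE (bigD1 (h i)) //= !mxE eqxx mulr1n big1 ?addr0.
      by rewrite intrM mulKf // intr_eq0.
    move=> l lh; rewrite !mxE /= eq_sym (_ : (val l == val (h i)) = false).
      by rewrite mul0r.
    exact/negbTE.
  by apply: scalemx_sub; apply: submx_trans DM; apply: row_sub.
apply/submxP; exists (\matrix_(i, j) f _ _ (L *m Dl) i (h j)).
rewrite {1}ME; apply/matrixP => i j; rewrite !mxE.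
rewrite [RHS](eq_bigr (fun l => f _ _ (L *m Dl) i (h l) * f _ _ U (h l) j)); last first.
  by move=> l _; rewrite !mxE.
rewrite -(big_enum_val (fun l => f _ _ (L *m Dl) i l * f _ _ U l j)) /=.
(* The columns of [L *m Dl] outside [S] vanish. *)
rewrite (bigID (mem S)) /= [X in _ + X]big1 ?addr0 // => l.
rewrite inE => lS; rewrite mxE mxE (_ : \sum__ _ = 0) ?mul0r //.
apply: big1 => t _; rewrite mxE; case: eqP => [tl|_]; last by rewrite mulr0n mulr0.
by move: lS; rewrite -tl ltn_ord /= negbK => /eqP ->; rewrite mul0rn mulr0.
Qed.

Definition dirmx D (V : seq 'rV[R]_D) (v0 : 'rV[R]_D) : 'M[R]_(size V, D) :=
  \matrix_(i < size V) (V`_i - v0).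

Lemma dirmx_mem D (V : seq 'rV[R]_D) v0 v : v \in V -> (v - v0 <= dirmx V v0)%MS.
Proof.
move=> vV; have hv : (index v V < size V)%N by rewrite index_mem.
suff -> : v - v0 = row (Ordinal hv) (dirmx V v0) by apply: row_sub.
by rewrite rowK /= nth_index.
Qed.

Lemma affine_combB D n (l : 'I_n -> R) (p : 'I_n -> 'rV[R]_D) (v0 : 'rV[R]_D) :
  \sum_i l i = 1 -> \sum_i l i *: p i - v0 = \sum_i l i *: (p i - v0).
Proof.
move=> l1; rewrite -{1}[v0]scale1r -l1 scaler_suml -sumrB.
by apply: eq_bigr => i _; rewrite scalerBr.
Qed.

(** Replaces affine hulls by row spaces, where [lattice_coordinates] applies. *)
Lemma in_aff_conv D (V : seq 'rV[R]_D) v0 x : v0 \in V ->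
  in_aff (conv V) x <-> (x - v0 <= dirmx V v0)%MS.
Proof.
move=> v0V; split.
  move=> [s [sV [l [l1 ->]]]]; rewrite affine_combB //.
  apply: summx_sub => i _; apply: scalemx_sub.
  have [m [_ [m1 ->]]] := sV i; rewrite affine_combB //.
  by apply: summx_sub => j _; apply: scalemx_sub; apply/dirmx_mem/mem_nth.
(* The coefficients [y] of the differences need not sum to 1; an extra copy of [v0] carries the
   missing weight. *)
move=> /submxP[y xy]; exists (v0 :: V); split.
  by move=> i; apply: wconv_mem; case: i => -[|i] hi //=; apply: mem_nth.
pose l (i : 'I_(size V).+1) :=
  if unlift ord0 i is Some j then y 0 j else 1 - \sum_j y 0 j.
have l0 : l ord0 = 1 - \sum_j y 0 j by rewrite /l unlift_none.
have lS i : l (lift ord0 i) = y 0 i by rewrite /l liftK.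
exists l; change (\sum_(i < (size V).+1) l i = 1 /\
  x = \sum_(i < (size V).+1) l i *: (v0 :: V)`_i).
rewrite !big_ord_recl l0.
split; first by rewrite [X in _ + X](eq_bigr (fun i => y 0 i)) ?subrK.
rewrite [X in _ + X](eq_bigr (fun i => y 0 i *: V`_i)) => [|i _]; last by rewrite lS.
rewrite -[x](subrK v0) xy mulmx_sum_row scalerBl scale1r [RHS]addrC addrCA addrC.
congr (_ + _); rewrite scaler_suml -sumrB; apply: eq_bigr => i _.
by rewrite rowK scalerBr.
Qed.

Lemma lattice_polytope_conv D (V : seq 'rV[R]_D) v0 : v0 \in V ->
  (forall v, v \in V -> v \is a mxOver Num.int) -> lattice_polytope (conv V).
Proof.
move=> v0V Vint; exists V; split; first by case: V v0V {Vint}.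
by split=> // i; apply/isZptP/Vint/mem_nth.
Qed.

Lemma lat_conv_linear D (V W : seq 'rV[R]_D) (A : 'M[R]_D) x :
  A \is a mxOver Num.int -> (forall v, v \in V -> v *m A \in W) ->
  lat (conv V) x -> lat (conv W) (x *m A).
Proof.
move=> Aint VW [[s [sV [l [l1 ->]]]] /isZptP xint]; split; last first.
  by apply/isZptP; apply: mxOverM.
exists [seq v *m A | v <- s]; split.
  move=> i; have hi : (i < size s)%N by rewrite -(size_map (mulmx^~ A) s).
  rewrite (nth_map 0) //; apply: conv_linear (sV (Ordinal hi)) => v /VW.
  exact: wconv_mem.
have e := size_map (mulmx^~ A) s.
have ebij : {on xpredT, bijective (cast_ord e)}.
  by exists (cast_ord (esym e)) => i _; rewrite ?cast_ordK ?cast_ordKV.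
exists (fun i => l (cast_ord e i)); split.
  by rewrite -l1 (reindex (cast_ord e)).
rewrite mulmx_suml (reindex (cast_ord e)) //=.
apply: eq_bigr => i _; rewrite -scalemxAl (nth_map 0) //.
by rewrite -(size_map (mulmx^~ A) s).
Qed.

Lemma unimod_equiv_conv D (V W : seq 'rV[R]_D) (A B : 'M[R]_D) :
  A \is a mxOver Num.int -> B \is a mxOver Num.int ->
  A *m B = 1%:M -> B *m A = 1%:M ->
  (forall v, v \in V -> v *m A \in W) -> (forall v, v \in W -> v *m B \in V) ->
  unimod_equiv (conv V) (conv W).
Proof.
move=> Aint Bint AB BA VW WV; exists A, 0; rewrite /affmap; split.
  split; first by move=> x hx; rewrite addr0; apply: lat_conv_linear hx.
  split.
    move=> x y _ _; rewrite !addr0 => /(congr1 (mulmx^~ B)) /=.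
    by rewrite -!mulmxA AB !mulmx1.
  move=> y hy; exists (y *m B); rewrite addr0 -mulmxA BA mulmx1; split=> //.
  exact: lat_conv_linear hy.
move=> y; split.
  move=> hy; exists (y *m B); rewrite addr0 -mulmxA BA mulmx1; split=> //.
  by apply: conv_linear hy => v /WV; apply: wconv_mem.
move=> [x [hx <-]]; rewrite addr0.
by apply: conv_linear hx => v /VW; apply: wconv_mem.
Qed.

Lemma unimod_equiv_eq_mem D (V W : seq 'rV[R]_D) :
  V =i W -> unimod_equiv (conv V) (conv W).
Proof.
move=> VW; have I1 : (1%:M : 'M[R]_D) \is a mxOver Num.int.
  by apply: mxOver_scalar; rewrite ?rpred0 ?rpred1.
by apply: (unimod_equiv_conv I1 I1); rewrite ?mulmx1 // => v; rewrite mulmx1 VW.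
Qed.

(** Since [w *m g = 0], the matrix [g *m w] squares to zero, so the shears along [w] and [- w] are
    mutually inverse integer maps. *)
Lemma unimod_equiv_shear D (V W : seq 'rV[R]_D) g w :
  g \is a mxOver Num.int -> w \is a mxOver Num.int -> w *m g = 0 ->
  (forall v, v \in V -> shear g w v \in W) ->
  (forall v, v \in W -> shear g (- w) v \in V) ->
  unimod_equiv (conv V) (conv W).
Proof.
move=> gint wint wg VW WV.
have I1 : (1%:M : 'M[R]_D) \is a mxOver Num.int.
  by apply: mxOver_scalar; rewrite ?rpred0 ?rpred1.
have sq : g *m w *m (g *m w) = 0 by rewrite mulmxA -(mulmxA g) wg mulmx0 mul0mx.
apply: (@unimod_equiv_conv D V W (1%:M - g *m w) (1%:M - g *m (- w))).
- by rewrite intmxD // intmxN // mxOverM.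
- by rewrite intmxD // intmxN // mxOverM // intmxN.
- by rewrite mulmxN opprK mulmxBl mul1mx mulmxDr mulmx1 sq addr0 addrK.
- by rewrite mulmxN opprK mulmxBr mulmx1 mulmxDl mul1mx sq addr0 addrK.
- by move=> v vV; rewrite -shearE VW.
- by move=> v vV; rewrite -shearE WV.
Qed.

Lemma pairingE d (f u : 'rV[R]_d) : pairing f u = (u *m f^T) 0 0.
Proof. by rewrite mxE; apply: eq_bigr => i _; rewrite !mxE mulrC. Qed.

Lemma pairing_sumr d n (f : 'I_n -> 'rV[R]_d) (l : 'I_n -> R) u :
  pairing (\sum_i l i *: f i) u = \sum_i l i * pairing (f i) u.
Proof.
rewrite pairingE linear_sum /= mulmx_sumr summxE; apply: eq_bigr => i _.
by rewrite linearZ /= -scalemxAr mxE pairingE.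
Qed.

(** A linear function on a segment attains its minimum at an endpoint. *)
Lemma is_umin_segment d (f u : 'rV[R]_d) (m : R) :
  is_umin (conv [:: 0; f]) u m <-> m = Num.min 0 (pairing f u).
Proof.
have p0 : pairing 0 u = 0 by rewrite pairingE trmx0 mulmx0 mxE.
have hge y : conv [:: 0; f] y -> Num.min 0 (pairing f u) <= pairing y u.
  move=> [l [l0 [l1 ->]]]; rewrite pairing_sumr.
  rewrite -[Num.min _ _]mul1r -l1 mulr_suml; apply: ler_sum => i _.
  apply: ler_wpM2l => //; case: i => -[|[|]] //= _.
    by rewrite p0 ge_min lexx.
  by rewrite ge_min lexx orbT.
have hin : exists y, conv [:: 0; f] y /\ pairing y u = Num.min 0 (pairing f u).
  have [h|h] := leP 0 (pairing f u).
    by exists 0; split=> //; apply: wconv_mem; rewrite inE eqxx.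
  by exists f; split=> //; apply: wconv_mem; rewrite !inE eqxx orbT.
split=> [[[y [hy <-]] hm]|->]; last by split.
apply/le_anti; rewrite hge // andbT; have [z [hz <-]] := hin.
exact: hm.
Qed.

(** The common points [u1], ..., [u4] put [w] into the direction spaces of both hulls. These spaces
    then coincide, and one chart, with origin [v0], serves both polytopes. *)
Lemma comb_mutation_conv D (V W : seq 'rV[R]_D) (g : 'cV[R]_D)
    (w v0 u1 u2 u3 u4 : 'rV[R]_D) :
  (forall v, v \in V -> v \is a mxOver Num.int) ->
  (forall v, v \in W -> v \is a mxOver Num.int) ->
  g \is a mxOver Num.int -> w \is a mxOver Num.int -> w *m g = 0 ->
  (exists i, w 0 i = 1) ->
  (forall v, v \in V -> ev g v = -1 \/ ev g v = 0 \/ ev g v = 1) ->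
  (forall v, v \in W -> ev g v = -1 \/ ev g v = 0 \/ ev g v = 1) ->
  (forall v, v \in V -> trop g w v \in W) ->
  (forall v, v \in W -> trop g (- w) v \in V) ->
  (forall v v', v \in V -> v' \in V -> ev g v = 1 -> ev g v' = -1 ->
     wconv W 2 (v + v')) ->
  (forall v v', v \in W -> v' \in W -> ev g v = 1 -> ev g v' = -1 ->
     wconv V 2 (v + v')) ->
  v0 \in V -> ev g v0 = 0 ->
  w = u1 + u2 - (u3 + u4) ->
  (forall u, u \in [:: u1; u2; u3; u4] -> u \in V /\ u \in W) ->
  comb_mutation (conv V) (conv W).
Proof.
move=> Vint Wint gint wint wg [i0 wi0] gV gW VW WV mV mW v0V gv0 wE hu.
have v0W : v0 \in W by have := VW _ v0V; rewrite /trop gv0 minxx scale0r subr0.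
have wdir X : (forall u, u \in [:: u1; u2; u3; u4] -> u \in X) ->
    (w <= dirmx X v0)%MS.
  move=> hX; have -> : w = (u1 - v0) + (u2 - v0) - ((u3 - v0) + (u4 - v0)).
    by rewrite wE (addrACA u1) (addrACA u3) [in RHS]opprD [RHS]addrACA subrr addr0.
  have hd u : u \in [:: u1; u2; u3; u4] -> (u - v0 <= dirmx X v0)%MS.
    by move=> /hX; apply: dirmx_mem.
  apply: addmx_sub; first by apply: addmx_sub; apply: hd; rewrite !inE eqxx ?orbT.
  by rewrite eqmx_opp; apply: addmx_sub; apply: hd; rewrite !inE eqxx ?orbT.
have wV : (w <= dirmx V v0)%MS by apply: wdir => u /hu[].
have wW : (w <= dirmx W v0)%MS by apply: wdir => u /hu[].
(* The tropical map moves each point by a multiple of [w], which lies in both direction spaces. *)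
have dVW : (dirmx V v0 :=: dirmx W v0)%MS.
  apply/eqmxP/andP; split; apply/row_subP => i; rewrite rowK.
    have := VW _ (mem_nth 0 (ltn_ord i)); set v := V`_i => /(dirmx_mem v0) h.
    have -> : v - v0 = (trop g w v - v0) + Num.min 0 (ev g v) *: w.
      by rewrite /trop addrAC subrK.
    by apply: addmx_sub => //; apply: scalemx_sub.
  have := WV _ (mem_nth 0 (ltn_ord i)); set v := W`_i => /(dirmx_mem v0) h.
  have -> : v - v0 = (trop g (- w) v - v0) - Num.min 0 (ev g v) *: w.
    by rewrite /trop scalerN opprK addrAC addrK.
  by apply: addmx_sub => //; rewrite eqmx_opp; apply: scalemx_sub.
have [|d [A [B [Aint [Bint [BA BE]]]]]] := @lattice_coordinates _ _ (dirmx V v0).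
  apply/mxOverP => i j; rewrite mxE; apply/mxOverP.
  by rewrite intmxD ?intmxN ?Vint // mem_nth.
have AB x : (x <= dirmx V v0)%MS -> x *m A *m B = x.
  by rewrite -BE => /submxP[y ->]; rewrite -mulmxA -mulmxA (mulmxA B A B) BA mul1mx.
pose b := - (v0 *m A).
have aff x : affmap A b x = (x - v0) *m A by rewrite /affmap /b mulmxBl.
have iso (X : seq 'rV[R]_D) : v0 \in X -> (dirmx X v0 :=: dirmx V v0)%MS ->
    lat_iso (affmap A b) (lat (conv X)) (@isZpt R d).
  move=> v0X dX.
  have latX x : lat (conv X) x <->
      (x - v0 <= dirmx V v0)%MS /\ x \is a mxOver Num.int.
    rewrite -dX; split=> -[h1 h2].
      by split; [apply/in_aff_conv | apply/isZptP].
    by split; [apply/(in_aff_conv _ v0X) | apply/isZptP].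
  split=> [x /latX[hx xint]|].
    by rewrite aff; apply/isZptP; rewrite mxOverM // intmxD // intmxN // Vint.
  split=> [x y /latX[hx _] /latX[hy _]|y /isZptP yint].
    rewrite !aff => /(congr1 (mulmx^~ B)) /=; rewrite !AB //.
    exact: addIr.
  exists (v0 + y *m B); rewrite aff addrC addrK -mulmxA BA mulmx1; split=> //.
  apply/latX; rewrite addrK; split; first by rewrite -BE submxMl.
  by rewrite intmxD ?mxOverM // Vint.
(* The form [g] in the coordinates of the chart; moving the origin to [v0] does not alter its
   values, as [g] vanishes there. *)
pose f := (B *m g)^T.
have fE x : conv V x -> pairing f ((x - v0) *m A) = ev g x.
  move=> hx; rewrite pairingE trmxK mulmxA AB.
    by rewrite mulmxBl mxE -/(ev g x) mxE -/(ev g v0) gv0 subr0.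
  apply/(in_aff_conv _ v0V); exists [:: x]; split.
    by move=> i; rewrite ord1.
  by exists (fun=> 1); rewrite !big_ord1 scale1r.
exists d, A, b, A, b, (w *m A), [:: 0; f].
split; first exact: (lattice_polytope_conv v0V).
split; first exact: (lattice_polytope_conv v0W).
split; first exact: iso.
split; first by apply: iso => //; apply: eqmx_sym.
split.
  by exists v0; rewrite aff subrr mul0mx; split=> //; apply: wconv_mem.
split.
  split; first by apply/isZptP; rewrite mxOverM.
  split.
    apply/eqP => wA0; have := AB _ _ wV; rewrite wA0 mul0mx => w0.
    by move: wi0; rewrite -w0 mxE => /esym/eqP; rewrite oner_eq0.
  (* Mapping [w *m A = c *: v] back by [B], the coordinate [i0] of [w] writes 1 as [c] times an
     integer, so [c] is a unit. *)
  move=> c v cint /isZptP vint wAE.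
  have cv : c * (v *m B) 0 i0 = 1.
    by rewrite -wi0 -[w](AB _ _ wV) wAE -scalemxAl [RHS]mxE.
  have : (v *m B) 0 i0 \is a Num.int by apply/(mxOverP (mxOverM vint Bint)).
  move: cint cv => /intrP[z ->] cv /intrP[z' zz']; move: cv; rewrite zz' -intrM.
  move=> /eqP; rewrite -[1]/(1%:~R) eqr_int => /eqP zz1.
  rewrite mulrC in zz1; have : (z == 1) || (z == -1) by exact: intUnitRing.unitzPl zz1.
  by case/orP => /eqP ->; [left | right].
split=> //; split.
  case=> -[|[|]] // hi /=.
    split; first by move=> i; rewrite mxE rpred0.
    by rewrite pairingE trmx0 mulmx0 mxE.
  split.
    apply/isZptP/mxOverP => i j; rewrite mxE.
    by apply/mxOverP; rewrite mxOverM.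
  have -> : pairing f (w *m A) = (w *m A *m (B *m g)) 0 0 by rewrite pairingE trmxK.
  by rewrite mulmxA AB // wg mxE.
move=> y; split.
  move=> [z [hz <-]].
  (* The preimage of [z] is found by applying the tropical map for [- w]. *)
  have wNg : - w *m g = 0 by rewrite mulNmx wg oppr0.
  have hx : conv V (trop g (- w) z) by apply: conv_trop hz.
  set x := trop g (- w) z in hx; have zx : trop g w x = z by apply: tropK.
  exists (affmap A b x); split; first by exists x.
  exists (Num.min 0 (ev g x)); rewrite !aff is_umin_segment fE //; split=> //.
  by rewrite -zx /trop addrAC mulmxBl scalemxAl.
move=> [_ [[x [hx <-]] [m []]]]; rewrite aff is_umin_segment fE // => -> ->.
exists (trop g w x); split; first exact: conv_trop hx.
by rewrite aff /trop addrAC mulmxBl scalemxAl.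
Qed.

End Lattices.

(** * Mutation steps from an exchange property of the vertices *)

Section MutationStep.
Variables (R : realType) (D : nat).
Implicit Types (V W : seq 'rV[R]_D) (g : 'cV[R]_D) (w : 'rV[R]_D).

(** Besides placing [v + v'] in twice the hull of [W], this supplies a common vertex [u] with
    [g = 0], the future origin of the mutation. *)
Definition exchangeable V W g : Prop :=
  forall v v', v \in V -> v' \in V -> ev g v = 1 -> ev g v' = -1 ->
  exists u u', [/\ u \in V /\ u \in W, u' \in V /\ u' \in W, ev g u = 0
                 & v + v' = u + u'].

Lemma exchangeable_wconv V W g : exchangeable V W g ->
  forall v v', v \in V -> v' \in V -> ev g v = 1 -> ev g v' = -1 ->
  wconv W 2 (v + v').
Proof.
move=> h v v' vV v'V e e'; have [u [u' [[_ uW] [_ uW'] _ ->]]] := h _ _ vV v'V e e'.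
by apply: wconvD; apply: wconv_mem.
Qed.

(** If no vertex has [g = -1], the tropical map fixes all vertices and the polytopes are equal; if
    none has [g = 1], it is a shear on all vertices and gives a unimodular equivalence. Otherwise
    the exchange property supplies the data of a genuine mutation. *)
Lemma mutation_step_trop V W g w :
  (forall v, v \in V -> v \is a mxOver Num.int) ->
  (forall v, v \in W -> v \is a mxOver Num.int) ->
  g \is a mxOver Num.int -> w \is a mxOver Num.int -> w *m g = 0 ->
  (exists i, w 0 i = 1) ->
  (forall v, v \in V -> ev g v = -1 \/ ev g v = 0 \/ ev g v = 1) ->
  (forall v, v \in W -> ev g v = -1 \/ ev g v = 0 \/ ev g v = 1) ->
  (forall v, v \in V -> trop g w v \in W) ->
  (forall v, v \in W -> trop g (- w) v \in V) ->
  exchangeable V W g -> exchangeable W V g ->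
  mutation_step (conv V) (conv W).
Proof.
move=> Vint Wint gint wint wg wi gV gW VW WV xV xW.
have wNg : - w *m g = 0 by rewrite mulNmx wg oppr0.
case: (boolP (has (fun v => ev g v == -1) V)) => [/hasP[v' v'V /eqP gv']|]; last first.
  move=> /hasPn noV; left; apply: unimod_equiv_eq_mem => v.
  have tropE w' v1 : 0 <= ev g v1 -> trop g w' v1 = v1.
    by move=> h; rewrite /trop min_l // scale0r subr0.
  apply/idP/idP => hv.
    rewrite -(tropE w v); first exact: VW.
    by case: (gV _ hv) (noV _ hv) => [->|[|] -> //]; rewrite eqxx.
  have := WV _ hv; have := noV _ (WV _ hv); rewrite ev_trop // => h.
  rewrite tropE //; by case: (gW _ hv) h => [->|[|] -> //]; rewrite eqxx.
case: (boolP (has (fun v => ev g v == 1) V)) => [/hasP[v vV /eqP gv]|]; last first.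
  move=> /hasPn noV; left; apply: (unimod_equiv_shear gint wint wg).
    move=> v hv; suff -> : shear g w v = trop g w v by apply: VW.
    rewrite /shear /trop min_r //.
    by case: (gV _ hv) (noV _ hv) => [->|[|] ->]; rewrite ?eqxx ?lerN10.
  move=> v hv; suff -> : shear g (- w) v = trop g (- w) v by apply: WV.
  rewrite /shear /trop min_r //; have := noV _ (WV _ hv); rewrite ev_trop //.
  by case: (gW _ hv) => [->|[|] ->]; rewrite ?eqxx ?lerN10.
right; left.
(* Exchanging [v] with [v'] in [V], and [v] with [v' + w] in [W], yields two pairs of common
   vertices whose sums differ by [w]. *)
have [u3 [u4 [[u3V u3W] [u4V u4W] gu3 e34]]] := xV _ _ vV v'V gv gv'.
have vW : v \in W by have := VW _ vV; rewrite /trop gv min_l // scale0r subr0.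
have := VW _ v'V; rewrite /trop gv' min_r ?lerN10 // scaleN1r opprK => v''W.
have gv'' : ev g (v' + w) = -1 by rewrite evD gv' {1}/ev wg mxE addr0.
have [u1 [u2 [[u1W u1V] [u2W u2V] _ e12]]] := xW _ _ vW v''W gv gv''.
have wE : w = u1 + u2 - (u3 + u4) by rewrite -e12 -e34 addrA (addrC (v + v')) addrK.
apply: (comb_mutation_conv Vint Wint gint wint wg wi gV gW VW WV _ _ u3V gu3 wE).
- exact: exchangeable_wconv.
- exact: exchangeable_wconv.
- by move=> u; rewrite !inE => /or4P[] /eqP ->.
Qed.

End MutationStep.

(** * Increasing lists of subsets, and matching fields given by an order *)

Definition lto n : rel 'I_n := fun x y => (x < y)%N.

Lemma lto_trans n : transitive (@lto n).
Proof. by move=> y x z; apply: ltn_trans. Qed.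

Lemma sorted_enum_set n (J : {set 'I_n}) : sorted (@lto n) (enum J).
Proof.
rewrite {1}/enum_mem; apply: (sorted_filter (@lto_trans n)).
rewrite -enumT; have : sorted ltn (map val (enum 'I_n)).
  by rewrite val_enum_ord iota_ltn_sorted.
by rewrite sorted_map.
Qed.

Lemma enum_set_sorted n (s : seq 'I_n) :
  sorted (@lto n) s -> enum [set x in s] = s.
Proof.
move=> ss; apply: (irr_sorted_eq (@lto_trans n)) => //.
- by move=> x; rewrite /lto ltnn.
- exact: sorted_enum_set.
- by move=> x; rewrite mem_enum inE.
Qed.

Definition pair_field k n (e : rel 'I_n) : matching_field k.+2 n :=
  fun J => if enum J is a :: b :: _ then
             if e a b then 1%g else tperm ord0 (inord 1)
           else 1%g.

(** Here [a] and [b] are the entries of rows 1 and 2, in either order of size, and [K] lists the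
    entries of the later rows. *)
Definition admissible k n (a b : 'I_n) (K : k.-tuple 'I_n) :=
  [&& a != b, path (@lto n) a K & path (@lto n) b K].

(** Only the heads of the tails matter. If both distributions of the tails failed, either some entry
    would exceed itself, or one of the pairs [a], [x] and [c], [d] would lie at or above the head of
    the other pair's tail, hence entirely above that pair; the two inequalities exclude this. *)
Lemma admissible_exchange k n (a x c d : 'I_n) (K K' : k.-tuple 'I_n) :
  admissible a x K -> admissible c d K' -> a != d -> c != x ->
  (minn c d < maxn a x)%N -> (minn a x < maxn c d)%N ->
  (admissible a d K' && admissible c x K) || (admissible a d K && admissible c x K').
Proof.
rewrite /admissible => /and3P[_ pa px] /and3P[_ pc pd] -> -> h5 h6.
case: k K K' pa px pc pd => [|m] K K'; first by rewrite (tuple0 K) (tuple0 K').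
case/tupleP: K => h K; case/tupleP: K' => h' K' /=; rewrite /lto.
by move=> /andP[h1 ->] /andP[h2 _] /andP[h3 ->] /andP[h4 _]; rewrite !andbT; lia.
Qed.

(** * Vertices of the matching field polytope of an order *)

Section Points.
Variables (R : realType) (k n : nat).
Implicit Types (a b c d x : 'I_n) (K : k.-tuple 'I_n) (e : rel 'I_n).

Definition entry (r : 'I_k.+2) x : 'rV[R]_(k.+2 * n) := mxvec (delta_mx r x).

(** Row 2, in the form that [big_ord_recl] produces. *)
Definition i1 : 'I_k.+2 := lift ord0 ord0.

Definition tail K := \sum_(i < k) entry (lift ord0 (lift ord0 i)) (tnth K i).

Definition pt a b K := entry ord0 a + entry i1 b + tail K.

Lemma inord1E : inord 1 = i1.
Proof. by apply: val_inj; rewrite /= inordK. Qed.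

Lemma entry_int r x : entry r x \is a mxOver Num.int.
Proof.
apply/mxOverP => i j; rewrite /entry mxvec_delta mxE.
by case: (_ && _); rewrite ?rpred0 ?rpred1.
Qed.

Lemma pt_int a b K : pt a b K \is a mxOver Num.int.
Proof.
apply: intmxD; first by apply: intmxD; apply: entry_int.
apply/mxOverP => i j; rewrite summxE rpred_sum // => l _.
exact: (mxOverP (entry_int _ _)).
Qed.

Lemma mxvec_expvec (s : 'S_k.+2) (J : {set 'I_n}) a b K :
  enum J = a :: b :: K ->
  mxvec (expvec R s J) = entry (s ord0) a + entry (s i1) b
    + \sum_(i < k) entry (s (lift ord0 (lift ord0 i))) (tnth K i).
Proof.
move=> EJ; have inner (r : 'I_k.+2) :
    \sum_(j | (j \in J) && (index j (enum J) == r)) delta_mx (s r) j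
    = delta_mx (s r) (nth a (enum J) r) :> 'M[R]_(_, _).
  have hr : (r < size (enum J))%N by rewrite EJ /= size_tuple.
  apply: big_pred1 => j; rewrite /= -mem_enum.
  apply/andP/eqP => [[jJ /eqP <-]|->]; first by rewrite nth_index.
  by rewrite mem_nth // index_uniq ?enum_uniq.
rewrite /expvec (eq_bigr _ (fun r _ => inner r)) linear_sum EJ /=.
rewrite !big_ord_recl /= addrA; congr (_ + _); apply: eq_bigr => i _.
by rewrite /entry -tnth_nth.
Qed.

Lemma tail_tperm (i : 'I_k) :
  tperm ord0 i1 (lift ord0 (lift ord0 i)) = lift ord0 (lift ord0 i).
Proof. by rewrite tpermD. Qed.

(** Totality of [e] selects exactly one arrangement of the two least elements of each set. *)
Lemma mem_pair_field_points e (v : 'rV[R]_(k.+2 * n)) :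
  (forall a b, a != b -> e a b = ~~ e b a) ->
  reflect (exists a b K, [/\ admissible a b K, e a b & v = pt a b K])
          (v \in mf_points R (pair_field k e)).
Proof.
move=> et; apply: (iffP mapP) => [[J]|[a [b [K [adm eab ->]]]]].
  rewrite mem_enum inE cardE => /eqP sJ ->.
  have sortJ := sorted_enum_set J.
  move E: (enum J) sJ sortJ => s0; case: s0 E => [|a [|b s]] // EJ [sz] srt.
  have [ab pb] : lto a b /\ path (@lto n) b s by apply/andP.
  have aNb : a != b by rewrite -val_eqE neq_ltn; apply/orP; left.
  have pa : path (@lto n) a s by apply: (path_le (@lto_trans n)) pb.
  have [K sK] : exists K : k.-tuple 'I_n, s = K by exists (Tuple (introT eqP sz)).
  rewrite sK in pa pb EJ.
  rewrite (mxvec_expvec _ EJ) /pair_field EJ; case: ifPn => eab.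
    exists a, b, K; rewrite /admissible aNb pa pb; split=> //.
    by rewrite !perm1; congr (_ + _); apply: eq_bigr => i _; rewrite perm1.
  (* The transposition puts the larger element [b] into row 1. *)
  exists b, a, K; rewrite /admissible eq_sym aNb pa pb; split=> //.
    by rewrite et // eq_sym.
  rewrite inord1E tpermL tpermR addrC [in RHS]/pt (addrC (entry _ b)) addrC.
  by congr (_ + _); apply: eq_bigr => i _; rewrite tail_tperm.
move: (adm) => /and3P[aNb pa pb].
have [ab|ba|/val_inj/eqP] := ltngtP a b; last by rewrite (negPf aNb).
  have EJ : enum [set x in [:: a, b & K]] = [:: a, b & K].
    by apply: enum_set_sorted; rewrite /= pb andbT.
  exists [set x in [:: a, b & K]].
    by rewrite mem_enum inE cardE EJ /= size_tuple.
  rewrite (mxvec_expvec _ EJ) /pair_field EJ eab.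
  by rewrite !perm1; congr (_ + _); apply: eq_bigr => i _; rewrite perm1.
have EJ : enum [set x in [:: b, a & K]] = [:: b, a & K].
  by apply: enum_set_sorted; rewrite /= pa andbT.
exists [set x in [:: b, a & K]].
  by rewrite mem_enum inE cardE EJ /= size_tuple.
have eba : e b a = false by apply/negbTE; rewrite -et.
rewrite (mxvec_expvec _ EJ) /pair_field EJ eba.
rewrite inord1E tpermL tpermR (addrC (entry _ b)).
by congr (_ + _); apply: eq_bigr => i _; rewrite tail_tperm.
Qed.

(** * Exchanging two consecutive elements of the order *)

Section Swap.
Variables (lo hi : pred 'I_n).

(** The coefficients of the form [g], with [lo] and [hi] the elements below and above the exchanged
    pair. *)
Definition height_mx : 'M[R]_(k.+2, n) :=
  \matrix_(i, j) (if i == ord0 then - (~~ lo j)%:R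
                  else if i == i1 then (hi j)%:R else 0).

Definition height := (mxvec height_mx)^T.

Lemma height_int : height \is a mxOver Num.int.
Proof.
apply/mxOverP => i j; rewrite mxE ord1; case/mxvec_indexP: i => i i'.
by rewrite mxvecE mxE; case: ifP => _; [|case: ifP => _];
  rewrite ?rpredN ?rpred0 ?intr_nat ?rpred_nat.
Qed.

Lemma ev_height_entry r x : ev height (entry r x) = height_mx r x.
Proof. by rewrite /ev /entry mxvec_delta -rowE mxE mxE mxvecE. Qed.

Lemma ev_height_pt a b K : ev height (pt a b K) = (hi b)%:R - (~~ lo a)%:R.
Proof.
rewrite /pt !evD !ev_height_entry !mxE /= ev_sum big1 ?addr0 1?addrC // => i _.
by rewrite ev_height_entry mxE.
Qed.

Lemma ev_height_values a b K : let h := ev height (pt a b K) in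
  h = -1 \/ h = 0 \/ h = 1.
Proof.
rewrite /= ev_height_pt; case: (hi b); case: (lo a); rewrite ?subr0 ?subrr ?sub0r;
by [left | right; left | right; right].
Qed.

Definition swapv c d := entry ord0 d + entry i1 c - (entry ord0 c + entry i1 d).

Lemma swapvN c d : - swapv c d = swapv d c.
Proof. by rewrite /swapv opprB. Qed.

Lemma pt_swapv c d K : pt c d K + swapv c d = pt d c K.
Proof. by rewrite /pt /swapv addrAC [X in X + tail K]addrC subrK. Qed.

Lemma swapv_int c d : swapv c d \is a mxOver Num.int.
Proof. by apply: intmxD; [|apply: intmxN]; apply: intmxD; apply: entry_int. Qed.

Lemma swapv_height c d : ~~ lo c -> ~~ lo d -> ~~ hi c -> ~~ hi d ->
  swapv c d *m height = 0.
Proof.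
move=> lc ld hc hd; apply/matrixP => i j; rewrite !ord1.
change (ev height (swapv c d) = (0 : 'M_1) 0 0).
rewrite /swapv -scaleN1r evD evZ !evD !ev_height_entry !mxE /=.
by rewrite lc ld (negPf hc) (negPf hd) !addr0 mulN1r subrr.
Qed.

Lemma swapv_entry c d : c != d -> exists i, swapv c d 0 i = 1.
Proof.
move=> cd; exists (mxvec_index ord0 d).
rewrite /swapv !mxE /entry !mxvecE !mxE /= !eqxx eq_sym (negPf cd).
by rewrite !addr0 subr0.
Qed.

(* [c] and [d] are consecutive in the order [e], with [lo] below and [hi] above. *)
Definition consecutive e c d : Prop :=
  [/\ e c d, (forall a, lo a -> e a c && e a d),
      (forall x, hi x -> e c x && e d x)
    & (forall a b, e a b -> [|| lo a, hi b | (a == c) && (b == d)])].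

Section Half.
Variables (e e' : rel 'I_n) (c d : 'I_n).
Hypothesis et : forall a b, a != b -> e a b = ~~ e b a.
Hypothesis et' : forall a b, a != b -> e' a b = ~~ e' b a.
Hypothesis ecd : consecutive e c d.
Hypothesis ecd' : consecutive e' d c.
Hypothesis ee' : forall a b, e a b -> (a == c) && (b == d) || e' a b.
Hypotheses (lc : ~~ lo c) (ld : ~~ lo d) (hc : ~~ hi c) (hd : ~~ hi d).
Hypothesis lohi : forall a x, lo a -> hi x ->
  (minn c d < maxn a x)%N /\ (minn a x < maxn c d)%N.

(** By [consecutive], a vertex whose first two entries are not [c], [d] has [lo a] or [hi b], hence
    [g] nonnegative, and stays in place. The inverse map is covered by exchanging the roles of [e],
    [e'] and of [c], [d]. *)
Lemma trop_swapv_mem v : v \in mf_points R (pair_field k e) ->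
  trop height (swapv c d) v \in mf_points R (pair_field k e').
Proof.
move=> /(mem_pair_field_points _ et)[a [b [K [adm eab ->]]]].
apply/(mem_pair_field_points _ et').
have [_ _ _ h] := ecd.
have [/andP[/eqP ac /eqP bd]|ncd] := boolP ((a == c) && (b == d)).
  exists d, c, K; split.
  - by move: adm; rewrite /admissible ac bd eq_sym => /and3P[-> -> ->].
  - by have [] := ecd'.
  - rewrite /trop ev_height_pt ac bd lc (negPf hd) sub0r min_r ?lerN10 //.
    by rewrite scaleN1r opprK pt_swapv.
exists a, b, K; split=> //.
  by have := ee' eab; rewrite (negPf ncd).
have := h _ _ eab; rewrite (negPf ncd) orbF /trop ev_height_pt => hl.
rewrite min_l ?scale0r ?subr0 //.
by move: hl; case: (lo a); case: (hi b); rewrite //= ?subrr ?subr0.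
Qed.

(** The values of [g] force [lo a] and [hi x] for [v], and first entries [c], [d] for [v']. After
    the exchange the pairs are [a], [d] and [c], [x], which both orders arrange in this way;
    [admissible_exchange] distributes the tails. *)
Lemma exchangeable_swapv : exchangeable (mf_points R (pair_field k e))
  (mf_points R (pair_field k e')) height.
Proof.
move=> v v' /(mem_pair_field_points _ et)[a [x [K [adm eax ->]]]].
move=> /(mem_pair_field_points _ et)[c1 [d1 [K' [adm' ecd1 ->]]]].
have [ec el eh h] := ecd; have [ec' el' eh' h'] := ecd'.
rewrite !ev_height_pt => h1 h2.
have [hx la] : hi x /\ lo a.
  by move: h1; case: (hi x); case: (lo a) => //=; lra.
have {h2} [hd1 lc1] : ~~ hi d1 /\ ~~ lo c1.
  by move: h2; case: (hi d1); case: (lo c1) => //=; lra.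
have := h _ _ ecd1; rewrite (negPf hd1) (negPf lc1) /= => /andP[/eqP ? /eqP ?].
subst c1 d1.
have [/andP[eac ead] /andP[ecx edx]] := (el _ la, eh _ hx).
have [/andP[ead' eac'] /andP[edx' ecx']] := (el' _ la, eh' _ hx).
have aNd : a != d by apply: contraNneq ld => <-.
have cNx : c != x by apply: contraNneq hc => ->.
have key (K1 K2 : k.-tuple 'I_n) : admissible a d K1 -> admissible c x K2 ->
    pt a x K + pt c d K' = pt a d K1 + pt c x K2 ->
    exists u u', [/\ u \in mf_points R (pair_field k e) /\
      u \in mf_points R (pair_field k e'),
      u' \in mf_points R (pair_field k e) /\ u' \in mf_points R (pair_field k e'),
      ev height u = 0 & pt a x K + pt c d K' = u + u'].
  move=> ad cx ->; exists (pt a d K1), (pt c x K2); split=> //.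
  - split; [apply/(mem_pair_field_points _ et)|apply/(mem_pair_field_points _ et')].
      by exists a, d, K1.
    by exists a, d, K1.
  - split; [apply/(mem_pair_field_points _ et)|apply/(mem_pair_field_points _ et')].
      by exists c, x, K2.
    by exists c, x, K2.
  - by rewrite ev_height_pt la (negPf hd) subrr.
have [m1 m2] := lohi la hx.
have base : entry ord0 a + entry i1 x + (entry ord0 c + entry i1 d) =
            entry ord0 a + entry i1 d + (entry ord0 c + entry i1 x).
  by rewrite addrACA [X in _ + X]addrC addrACA.
have /orP[/andP[A1 A2]|/andP[A1 A2]] := admissible_exchange adm adm' aNd cNx m1 m2.
  apply: (key K' K) => //; rewrite /pt addrACA [RHS]addrACA base.
  by congr (_ + _); rewrite addrC.
by apply: (key K K') => //; rewrite /pt addrACA [RHS]addrACA base.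
Qed.

End Half.

Lemma mutation_step_swap e e' c d :
  (forall a b, a != b -> e a b = ~~ e b a) ->
  (forall a b, a != b -> e' a b = ~~ e' b a) ->
  c != d -> consecutive e c d -> consecutive e' d c ->
  (forall a b, e a b -> (a == c) && (b == d) || e' a b) ->
  (forall a b, e' a b -> (a == d) && (b == c) || e a b) ->
  ~~ lo c -> ~~ lo d -> ~~ hi c -> ~~ hi d ->
  (forall a x, lo a -> hi x ->
    (minn c d < maxn a x)%N /\ (minn a x < maxn c d)%N) ->
  mutation_step (mf_polytope (R := R) (pair_field k e)) (mf_polytope (pair_field k e')).
Proof.
move=> et et' cd ecd ecd' ee' e'e lc ld hc hd lohi.
have lohi' a x : lo a -> hi x ->
    (minn d c < maxn a x)%N /\ (minn a x < maxn d c)%N.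
  by move=> la hx; rewrite minnC (maxnC d); apply: lohi.
apply: (@mutation_step_trop _ _ _ _ height (swapv c d)).
- by move=> v /(mem_pair_field_points _ et)[a [b [K [_ _ ->]]]]; apply: pt_int.
- by move=> v /(mem_pair_field_points _ et')[a [b [K [_ _ ->]]]]; apply: pt_int.
- exact: height_int.
- exact: swapv_int.
- exact: swapv_height.
- exact: swapv_entry.
- move=> v /(mem_pair_field_points _ et)[a [b [K [_ _ ->]]]].
  exact: ev_height_values.
- move=> v /(mem_pair_field_points _ et')[a [b [K [_ _ ->]]]].
  exact: ev_height_values.
- by move=> v; apply: trop_swapv_mem.
- by move=> v; rewrite swapvN; apply: trop_swapv_mem.
- exact: exchangeable_swapv lohi.
- exact: exchangeable_swapv lohi'.
Qed.

End Swap.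

End Points.

(** * Chains of mutation steps *)

Section Chains.
Variables (R : realType) (k n : nat).
Implicit Types L : matching_field k n.

Definition mutation_chain L L' : Prop :=
  exists (m : nat) (Lam : nat -> matching_field k n),
    Lam 0%N = L /\ Lam m = L' /\
    forall i : nat, (i < m)%N ->
      mutation_step (mf_polytope (R := R) (Lam i)) (mf_polytope (Lam i.+1)).

Lemma mutation_chain_refl L : mutation_chain L L.
Proof. by exists 0%N, (fun=> L). Qed.

Lemma mutation_chain_step L L' :
  mutation_step (mf_polytope (R := R) L) (mf_polytope L') -> mutation_chain L L'.
Proof.
move=> h; exists 1%N, (fun i => if i is 0 then L else L').
by do 2 split=> //; case.
Qed.

Lemma mutation_chain_trans L1 L2 L3 :
  mutation_chain L1 L2 -> mutation_chain L2 L3 -> mutation_chain L1 L3.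
Proof.
move=> [m [f [f0 [fm hf]]]] [p [g [g0 [gp hg]]]].
(* At the seam [i = m] both chains have the value [L2]. *)
exists (m + p)%N, (fun i => if (i <= m)%N then f i else g (i - m)%N).
split=> //; split.
  case: p gp {hg} => [|p] gp; first by rewrite addn0 leqnn fm -g0 gp.
  by have -> : (m + p.+1 <= m)%N = false by [lia]; rewrite addKn.
move=> i hi; have [im|im|im] := ltngtP i m.
- exact: hf.
- by rewrite subSn ?(ltnW im) //; apply: hg; lia.
- by rewrite im fm -g0 subSnn; apply: hg; lia.
Qed.

Lemma mutation_chain_iter (f : nat -> matching_field k n) i j : (i <= j)%N ->
  (forall m, (i <= m < j)%N -> mutation_chain (f m) (f m.+1)) ->
  mutation_chain (f i) (f j).
Proof.
elim: j => [|j IH]; first by rewrite leqn0 => /eqP -> _; apply: mutation_chain_refl.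
rewrite leq_eqVlt => /orP[/eqP -> _|ij h]; first exact: mutation_chain_refl.
apply: mutation_chain_trans (h j _); last by lia.
by apply: IH => // m hm; apply: h; lia.
Qed.

(** A [matching_field] also has values at sets of other sizes, so two fields with the same polytope
    may differ as functions; the identity equivalence links them. *)
Lemma mutation_chain_eq L L' :
  (forall J : {set 'I_n}, #|J| = k -> L J = L' J) -> mutation_chain L L'.
Proof.
move=> h; apply: mutation_chain_step; left; apply: unimod_equiv_eq_mem => v.
rewrite /mf_points; congr (v \in _); apply/eq_in_map => J.
by rewrite mem_enum inE => /eqP /h ->.
Qed.

End Chains.

(** * Block diagonal matching fields as orders, and the path between them *)

Lemma block_diag_pair_field k n l (e : rel 'I_n) (J : {set 'I_n}) :
  (forall a b : 'I_n, (a < b)%N -> e a b = ~~ ((a < l)%N && (l <= b)%N)) ->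
  #|J| = k.+2 -> @block_diag k.+2 n l J = pair_field k e J.
Proof.
move=> he cJ; rewrite /block_diag /pair_field.
have -> : #|[set j in J | (j < l)%N]| = count (fun j : 'I_n => (j < l)%N) (enum J).
  by rewrite -sum1dep_card -big_enum_cond sum1_count.
rewrite cardE in cJ; have srt := sorted_enum_set J.
move: (enum J) cJ srt => [|a [|b s]] // _ srt.
have [ab pb] : lto a b /\ path (@lto n) b s by apply/andP.
(* In an increasing list starting with [a], [b], exactly one element is below [l] if and only if
   [a < l <= b]. *)
rewrite he //=; have := order_path_min (@lto_trans n) pb => /allP bs.
have [bl|lb] := ltnP b l.
  by have -> : (a < l)%N by [exact: ltn_trans ab bl].
have -> : count (fun j : 'I_n => (j < l)%N) s = 0%N.
  apply/eqP; rewrite -leqn0 leqNgt -has_count; apply/hasPn => j /bs bj.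
  by rewrite -leqNgt ltnW // (leq_ltn_trans lb bj).
by rewrite andbT; case: (a < l)%N.
Qed.

(* Positions, up to a monotone relabelling, in the order obtained from
   p+1, ..., n-1, 0, ..., p-1 by inserting p before its t-th entry. *)
Definition rank n p t x :=
  if x == p then t.*2 else (if p < x then x - p.+1 else x + n - p.+1)%N.*2.+1.

Definition rank_rel n p t : rel 'I_n := fun x y => (rank n p t x < rank n p t y)%N.

Lemma rank_rel_total n p t (a b : 'I_n) : (p < n)%N ->
  a != b -> rank_rel p t a b = ~~ rank_rel p t b a.
Proof.
move=> pn; rewrite -val_eqE /rank_rel /rank /= => ab.
have := ltn_ord a; have := ltn_ord b.
case: eqP => ap; case: eqP => bp; case: (ltnP p a) => pa; case: (ltnP p b) => pb; lia.
Qed.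

Lemma rank_step R k n p t : (p < n)%N -> (t < n.-1)%N ->
  mutation_step (mf_polytope (R := R) (pair_field k (@rank_rel n p t)))
                (mf_polytope (pair_field k (@rank_rel n p t.+1))).
Proof.
move=> pn tn.
(* The element that [p] passes: entry [t], counted from 0, of the rotation p+1, ..., n-1, 0, ...,
   p-1. Its rank 2t+1 lies between the ranks 2t and 2t+2 of [p] before and after the step. *)
pose q := if (p + t.+1 < n)%N then (p + t.+1)%N else (p + t.+1 - n)%N.
have qn : (q < n)%N by rewrite /q; case: ifP; lia.
have qp : q != p by rewrite /q; case: ifP; lia.
have rq s : rank n p s q = t.*2.+1.
  rewrite /rank (negPf qp) /q; case: (ltnP (p + t.+1) n) => h; case: ifP; lia.
have rp s : rank n p s p = s.*2 by rewrite /rank eqxx.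
have rx s x : x != p -> rank n p s x = rank n p t x by rewrite /rank => /negPf ->.
have ro x : x != p -> odd (rank n p t x).
  by rewrite /rank => /negPf -> /=; rewrite odd_double.
have rinj x : (x < n)%N -> x != p -> x != q -> rank n p t x <> t.*2.+1.
  move=> xn xp; rewrite /rank (negPf xp) /q.
  case: (ltnP (p + t.+1) n) => h; case: ltnP; lia.
pose P := Ordinal pn; pose Q := Ordinal qn.
pose lo (x : 'I_n) := (x != P) && (rank n p t x < t.*2)%N.
pose hi (x : 'I_n) := (x != P) && (t.*2.+1 < rank n p t x)%N.
(* The remaining elements have odd ranks other than 2t+1, so each is on the same side of both
   positions of [p]. *)
have key (x : 'I_n) : [\/ x = P, x = Q | [/\ x != P, x != Q &
    forall s, rank n p s x = rank n p t x] /\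
    ((rank n p t x < t.*2)%N \/ (t.*2.+2 < rank n p t x)%N)].
  have [->|xP] := eqVneq x P; first by constructor 1.
  have [->|xQ] := eqVneq x Q; first by constructor 2.
  constructor 3; split; first by split=> // s; apply: rx.
  have := ro x xP; have := rinj _ (ltn_ord x) xP xQ; lia.
have PQ : (P == Q) = false by rewrite eq_sym; apply/negbTE.
have QP : (Q == P) = false by apply/negbTE.
apply: (@mutation_step_swap _ _ _ lo hi _ _ P Q).
- by move=> a b; apply: rank_rel_total.
- by move=> a b; apply: rank_rel_total.
- by rewrite PQ.
- split; rewrite /lo /hi /rank_rel /= ?rp ?rq.
  + lia.
  + move=> a /andP[_]; rewrite ?rp ?rq; lia.
  + move=> a /andP[_]; rewrite ?rp ?rq; lia.
  + move=> a b.
    case: (key a) => [->|->|[[/negPf aP /negPf aQ _] ha]];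
    case: (key b) => [->|->|[[/negPf bP /negPf bQ _] hb]];
    rewrite ?rp ?rq ?eqxx ?PQ ?QP ?aP ?aQ ?bP ?bQ /=; lia.
- split; rewrite /lo /hi /rank_rel /= ?rp ?rq.
  + lia.
  + move=> a /andP[aP]; rewrite (rx t.+1) // ?rp ?rq; lia.
  + move=> a /andP[aP]; rewrite (rx t.+1) // ?rp ?rq.
    by have := ro a aP; lia.
  + move=> a b.
    case: (key a) => [->|->|[[/negPf aP /negPf aQ ea] ha]];
    case: (key b) => [->|->|[[/negPf bP /negPf bQ eb] hb]];
    rewrite ?rp ?rq ?ea ?eb ?eqxx ?PQ ?QP ?aP ?aQ ?bP ?bQ /=; lia.
- rewrite /rank_rel => a b.
  case: (key a) => [->|->|[[/negPf aP /negPf aQ ea] ha]];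
  case: (key b) => [->|->|[[/negPf bP /negPf bQ eb] hb]];
  rewrite ?rp ?rq ?ea ?eb ?eqxx ?PQ ?QP ?aP ?aQ ?bP ?bQ /=; lia.
- rewrite /rank_rel => a b.
  case: (key a) => [->|->|[[/negPf aP /negPf aQ ea] ha]];
  case: (key b) => [->|->|[[/negPf bP /negPf bQ eb] hb]];
  rewrite ?rp ?rq ?ea ?eb ?eqxx ?PQ ?QP ?aP ?aQ ?bP ?bQ /=; lia.
- by rewrite /lo eqxx.
- by rewrite /lo QP /= rq; lia.
- by rewrite /hi eqxx.
- by rewrite /hi QP /= rq; lia.
(* If [p < q] then [a] lies strictly between them; if [q < p] then [x] does. Either gives both
   inequalities. *)
- move=> a x; rewrite /lo /hi => /andP[]; rewrite -!val_eqE /= => aP + /andP[xP].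
  have := ltn_ord a; have := ltn_ord x; rewrite /rank (negPf aP) (negPf xP) /q.
  case: (ltnP (p + t.+1) n) => h; case: (ltnP p a) => pa; case: (ltnP p x) => px; lia.
Qed.

(** With [p] in first place the order is p, ..., n-1, 0, ..., p-1 and gives the field of [p]; with
    [p] in last place it gives that of [p.+1]. *)
Lemma block_diag_succ R k n p : (p < n)%N ->
  mutation_chain R (@block_diag k.+2 n p) (@block_diag k.+2 n p.+1).
Proof.
move=> pn; apply: (@mutation_chain_trans _ _ _ _ (pair_field k (@rank_rel n p 0))).
  apply: mutation_chain_eq => J; apply: block_diag_pair_field => a b ab.
  have := ltn_ord b; rewrite /rank_rel /rank /=.
  case: eqP => ap; case: eqP => bp; case: (ltnP p a) => pa; case: (ltnP p b) => pb; lia.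
apply: (@mutation_chain_trans _ _ _ _ (pair_field k (@rank_rel n p n.-1))); last first.
  apply: mutation_chain_eq => J cJ; apply/esym.
  apply: block_diag_pair_field cJ => a b ab.
  have := ltn_ord b; rewrite /rank_rel /rank /=.
  case: eqP => ap; case: eqP => bp; case: (ltnP p a) => pa; case: (ltnP p b) => pb; lia.
apply: (mutation_chain_iter (f := fun t => pair_field k (@rank_rel n p t)))  => //.
by move=> t /andP[_ tn]; apply/mutation_chain_step/rank_step.
Qed.

Lemma block_diag_le R k n l l' : (l <= l')%N -> (l' <= n)%N ->
  mutation_chain R (@block_diag k.+2 n l) (@block_diag k.+2 n l').
Proof.
move=> ll' hl'; apply: (mutation_chain_iter (f := @block_diag k.+2 n)) => //.
by move=> m hm; apply: block_diag_succ; lia.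
Qed.

Theorem theorem1p2 (R : realType) (k n : nat) (hk : (2 <= k)%N) (hkn : (k <= n)%N)
  (l l' : nat) (hl : (l <= n)%N) (hl' : (l' <= n)%N) :
  exists (m : nat) (Lam : nat -> matching_field k n),
    Lam 0%N = @block_diag k n l /\ Lam m = @block_diag k n l' /\
    forall i : nat, (i < m)%N ->
      mutation_step (@mf_polytope R k n (Lam i)) (@mf_polytope R k n (Lam i.+1)).
Proof.
case: k hk hkn => [|[|k]] // _ _.
(* The path climbs from [l] to [n], passes to 0 and climbs to [l'], so no chain has to be
   reversed. *)
apply: (@mutation_chain_trans _ _ _ _ (@block_diag k.+2 n n)).
  exact: block_diag_le.
apply: (@mutation_chain_trans _ _ _ _ (@block_diag k.+2 n 0)); last first.
  exact: block_diag_le.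
(* For [n] and for 0 the field is that of the natural order, the identity on all sets of the right
   size. *)
apply: mutation_chain_eq => J cJ.
rewrite !(@block_diag_pair_field _ _ _ (@lto n)) // => a b ab; rewrite /lto ab //.
by rewrite (leqNgt n) !ltn_ord.
Qed.
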